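(* Let $n, r \geq 1$ be integers, let $\mathcal{T}_n \subseteq \mathbb{C}^{n\times n}$ be the affine variety of $n\times n$ Toeplitz matrices and $\mathcal{H}_n \subseteq \mathbb{C}^{n\times n}$ the affine variety of $n \times n$ Hankel matrices. Then $$\dim \mu_r(\mathcal{T}_n) = \dim \mu_r(\mathcal{H}_n) = \min\{n^2,\ 2r(n-1)+1\}.$$
   Context: For an affine variety $X \subseteq \mathbb{C}^{n\times n}$ and an integer $r \geq 1$, let $\mu_r^0(X) = \{M_1\cdots M_r : M_1,\dots,M_r \in X\}$ be the set of all products of $r$ matrices in $X$, and let $\mu_r(X) = \overline{\mu_r^0(X)}^{\mathrm{Zar}}$ be its Zariski closure in $\mathbb{C}^{n\times n}$ (the $r$-th $X$-factorization variety). A matrix is Toeplitz if its $(i,j)$-entry depends only on $j-i$, and Hankel if its $(i,j)$-entry depends only on $i+j$. Dimension is the (Krull) dimension of an affine variety over $\mathbb{C}$. *)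

(* Defs.v *)
From HB Require Import structures.
From mathcomp Require Import all_boot all_order all_algebra.
From mathcomp Require Import classical_sets reals complex.
From mathcomp Require Import mpoly.

Set Implicit Arguments.
Unset Strict Implicit.
Unset Printing Implicit Defensive.

Import GRing.Theory.

Local Open Scope ring_scope.
Local Open Scope classical_set_scope.

(* The variables of {mpoly K[n * n]} are the matrix entries, in the
   row-major order of mxvec. *)
Definition zero_locus (K : fieldType) (n : nat)
    (I : set {mpoly K[n * n]}) : set 'M[K]_n :=
  [set A : 'M[K]_n | forall p, I p -> p.@[fun k => mxvec A 0 k] = 0].

Definition zariski_closed (K : fieldType) (n : nat) : set (set 'M[K]_n) :=
  [set Z | exists I : set {mpoly K[n * n]}, Z = zero_locus I].

Definition zariski_closure (K : fieldType) (n : nat)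
    (S : set 'M[K]_n) : set 'M[K]_n :=
  smallest (@zariski_closed K n) S.

Definition irreducible_closed (K : fieldType) (n : nat)
    (Z : set 'M[K]_n) : Prop :=
  [/\ zariski_closed Z, Z !=set0 &
      forall A B : set 'M[K]_n, zariski_closed A -> zariski_closed B ->
        Z = A `|` B -> Z = A \/ Z = B].

(* A chain Z 0 < Z 1 < ... < Z k of length k has k + 1 members; the values of
   Z beyond k are irrelevant. *)
Definition irreducible_chain (K : fieldType) (n : nat) (X : set 'M[K]_n)
    (k : nat) (Z : nat -> set 'M[K]_n) : Prop :=
  (forall i, (i <= k)%N -> irreducible_closed (Z i) /\ Z i `<=` X) /\
  (forall i, (i < k)%N -> Z i `<` Z i.+1).

(* Krull dimension as a relation: d is the maximal length of a chain of
   irreducible closed subsets of X. It is meant for Zariski closed X, for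
   which closed subsets of X are the closed sets contained in X. *)
Definition has_krull_dim (K : fieldType) (n : nat) (X : set 'M[K]_n)
    (d : nat) : Prop :=
  (exists Z, irreducible_chain X d Z) /\
  (forall k Z, irreducible_chain X k Z -> (k <= d)%N).

Definition products (K : fieldType) (n r : nat)
    (X : set 'M[K]_n) : set 'M[K]_n :=
  [set P : 'M[K]_n | exists M : 'I_r -> 'M[K]_n,
     (forall i, X (M i)) /\ P = \big[mulmx/1%:M]_(i < r) M i].

Definition factorization_variety (K : fieldType) (n r : nat)
    (X : set 'M[K]_n) : set 'M[K]_n :=
  zariski_closure (products r X).

Definition toeplitz (K : fieldType) (n : nat) : set 'M[K]_n :=
  [set A : 'M[K]_n | forall i j i' j' : 'I_n,
     j%:Z - i%:Z = j'%:Z - i'%:Z -> A i j = A i' j'].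

Definition hankel (K : fieldType) (n : nat) : set 'M[K]_n :=
  [set A : 'M[K]_n | forall i j i' j' : 'I_n,
     (i + j = i' + j')%N -> A i j = A i' j'].

(* Main.v *)
Require Import Defs.
From mathcomp Require Import all_boot all_order all_algebra.
From mathcomp Require Import classical_sets reals complex.
From mathcomp Require Import mpoly.
From HB Require Import structures.
From mathcomp Require Import boolp zify.

(** Put m = n - 1, and let S be the set of products of r matrices that are all
    Toeplitz, or all Hankel.

    The dimension is at most n^2 and at most 2rm + 1. Climbing one step in a
    chain of irreducible closed sets makes room for one more algebraically
    independent polynomial, namely one that vanishes on the smaller set and not
    on the larger one (alg_indep_step). So a chain of length k in the closure of
    S gives k polynomials that are algebraically independent on S. If S lies in
    the closure of the image of a polynomial map from K^d, then k <= d, because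
    more than d polynomials in d variables are dependent: they have too many
    monomials of bounded degree (mpoly_alg_dep). One such map is the
    identification of K^(n^2) with the space of matrices. Another writes a
    product of r members of a (2m + 1)-dimensional space as a scalar times a
    product of members with first coordinate 1, which takes 1 + 2rm parameters
    and reaches a dense part of S (products_param).

    For the lower bound, let phi be a polynomial map from K^d to S with injective
    differential at 0. The closures of the images of the coordinate subspaces
    K^0, K^1, ..., K^d are irreducible, and they are pairwise distinct: i + 1
    suitable linear functions of phi x - phi 0 agree to first order with the
    first i + 1 coordinates of x, hence are independent on the image of K^(i+1),
    while on the image of K^i they are dependent (exists_chain_of_immersion).

    It remains to find Toeplitz matrices A_j at which the differential of the
    product, the sum of the A_0 ... A_(j-1) X_j A_(j+1) ... A_(r-1), has large
    rank. Take A_j = 1 + s B_j with B_0 = 0, and X_j = u_(j+1) - u_j with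
    u_0 = 0 and u_r = s Y. Summation by parts makes the differential s times an
    expression (dprod_abel) whose value at s = 0 is
      Y + sum over 0 < j < r of (u_j B_j - B_(j-1) u_j),
    and injectivity at s = 0 implies injectivity at some s <> 0
    (row_free_specialize). The difference of a matrix and its shift along the
    diagonal kills the Toeplitz matrix Y and turns a product of two Toeplitz
    matrices into a matrix of rank at most two (shift_diff_mul). When the B_j
    are suitable unit vectors, the coefficients of the u_j form vectors v_l in
    K^m, with l < min(m, 2(r-1)), and the (i, l) entry of the shifted difference
    is v_l[i] + v_(i+2)[l]. If all of these vanish, then following the indices
    upwards gives v = 0 (limit_injective). The number of parameters,
    min(m, 2(r-1)) m + 2m + 1, is the dimension claimed.

    Multiplying by the exchange matrix, which reverses the order of the rows or
    the columns, exchanges Toeplitz and Hankel matrices, and products of r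
    Hankel matrices include all products of r Toeplitz matrices up to a fixed
    invertible factor (hankel_products). *)

Set Implicit Arguments.
Unset Strict Implicit.
Unset Printing Implicit Defensive.

Import GRing.Theory.

Local Open Scope ring_scope.
Local Open Scope classical_set_scope.

(** * Zeros of polynomials over an infinite field *)

Definition infinite_field (K : fieldType) :=
  forall s : seq K, exists x, x \notin s.

(** The point is taken nonzero because it will serve as a small deformation
    parameter, by which one divides. *)
Lemma exists_nonzero_nonroot (K : fieldType) (p : {poly K}) :
  infinite_field K -> p != 0 -> exists2 z, z != 0 & p.[z] != 0.
Proof.
move=> Kinf p0; apply: contrapT => nz.
have nzq : 'X * p != 0 by rewrite mulf_neq0 ?polyX_eq0.
have rts : forall s : seq K, exists t, [/\ uniq t, size t = size s & all (root ('X * p)) t].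
  elim=> [|a s [t [ut st rt]]]; first by exists [::].
  have [x xt] := Kinf t; exists (x :: t); split=> //=; rewrite ?xt ?st //.
  rewrite rt andbT rootE hornerM hornerX mulf_eq0.
  by have [//|x0] := eqVneq x 0; apply/negPn/negP => px; apply: nz; exists x.
have [t [ut st rt]] := rts (nseq (size ('X * p)) 0).
by have := max_poly_roots nzq rt ut; rewrite st size_nseq ltnn.
Qed.

Lemma msupp_min (K : fieldType) k (w : 'X_{1..k} -> nat) (F : {mpoly K[k]}) : F != 0 ->
  exists2 m0, m0 \in msupp F & forall m, m \in msupp F -> (w m0 <= w m)%N.
Proof.
move=> F0.
have [m mF] : exists m, m \in msupp F.
  have : msupp F != [::] by rewrite msupp_eq0.
  by case: (msupp F) => // m s _; exists m; rewrite mem_head.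
have ex : exists e, has (fun m => w m == e) (msupp F).
  by exists (w m); apply/hasP; exists m.
case: (ex_minnP ex) => e /hasP[m1 m1F /eqP <-] min1.
by exists m1 => // m' m'F; apply: min1; apply/hasP; exists m'.
Qed.

Definition mnm_restrict k (m : 'X_{1..k.+1}) : 'X_{1..k} :=
  [multinom m (widen_ord (leqnSn k) i) | i < k].

(** Taking out the largest power of the last variable that divides F leaves a
    polynomial F0 in the other variables, which is nonzero. This is what makes
    induction on the number of variables work. *)
Lemma mpoly_split_last (K : fieldType) k (F : {mpoly K[k.+1]}) : F != 0 ->
  exists (e : nat) (F0 : {mpoly K[k]}) (F1 : {mpoly K[k.+1]}), F0 != 0 /\
    forall v : 'I_k.+1 -> K,
      F.@[v] = v ord_max ^+ e *
        (F0.@[fun i => v (widen_ord (leqnSn k) i)] + v ord_max * F1.@[v]).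
Proof.
move=> F0.
have [m0 m0F min0] := msupp_min (fun m : 'X_{1..k.+1} => m ord_max) F0.
pose e := m0 ord_max.
pose G0 := \sum_(m <- msupp F | m ord_max == e) F@_m *: 'X_[mnm_restrict m] : {mpoly K[k]}.
pose G1 : {mpoly K[k.+1]} :=
  \sum_(m <- msupp F | m ord_max != e) F@_m *: 'X_[m - U_(ord_max) *+ e.+1].
exists e, G0, G1; split.
  apply/eqP => /(congr1 (mcoeff (mnm_restrict m0))) /eqP.
  rewrite mcoeff0 /G0 raddf_sum /= big_mkcond (bigD1_seq m0) ?msupp_uniq //= eqxx.
  rewrite big_seq_cond big1 ?addr0.
    by rewrite mcoeffZ mcoeffX eqxx mulr1 -[_ == 0]negbK -mcoeff_msupp m0F.
  move=> m /andP[mF mm0]; case: eqP => // me; rewrite mcoeffZ mcoeffX.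
  case: eqP => [E|]; last by rewrite mulr0.
  case/eqP: mm0; apply/mnmP => i.
  have [->//|ne] := eqVneq i ord_max.
  have ik : (i < k)%N.
    rewrite ltn_neqAle -ltnS ltn_ord andbT.
    by apply: contra ne => /eqP E'; apply/eqP/val_inj.
  have /mnmP/(_ (Ordinal ik)) := E; rewrite !mnmE.
  by have -> : widen_ord (leqnSn k) (Ordinal ik) = i by apply: val_inj.
move=> v.
rewrite mulrDr mevalE (bigID (fun m : 'X_{1.. k.+1} => m ord_max == e)) /=.
congr (_ + _).
  rewrite /G0 raddf_sum big_distrr /=; apply: eq_bigr => m /eqP me.
  rewrite mevalZ mevalX big_ord_recr /= me mulrA [RHS]mulrC; congr (_ * _ * _).
  by apply: eq_bigr => i _; rewrite mnmE.
rewrite mulrA -exprSr /G1 raddf_sum big_distrr /= big_seq_cond [RHS]big_seq_cond.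
apply: eq_bigr => m /andP[mF me].
have lt : (e < m ord_max)%N by rewrite ltn_neqAle eq_sym me min0.
rewrite mevalZ mevalX mulrCA; congr (_ * _).
rewrite (bigD1 ord_max) //= [in RHS](bigD1 ord_max) //= mulrA; congr (_ * _).
  by rewrite mnmBE mulmnE mnm1E eqxx mul1n -exprD subnKC.
by apply: eq_bigr => i ne; rewrite mnmBE mulmnE mnm1E eq_sym (negPf ne) mul0n subn0.
Qed.

(** By induction the constant term F0 in the last variable does not vanish at some
    point w; above w there remains a nonzero polynomial in one variable. *)
Lemma mpoly_exists_nonroot (K : fieldType) k (F : {mpoly K[k]}) :
  infinite_field K -> F != 0 -> exists v : 'I_k -> K, F.@[v] != 0.
Proof.
move=> Kinf; elim: k F => [|k IH] F F0.
  exists (fun=> 0); rewrite -[F]mpolyKC mevalC; apply: contra F0 => /eqP h.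
  by rewrite -[F]mpolyKC h mpolyC0.
have [e [F0' [F1 [F0'0 FE]]]] := mpoly_split_last F0.
have [w Fw] := IH _ F0'0.
pose ext (z : K) (i : 'I_k.+1) := if unlift ord_max i is Some j then w j else z.
have extm z : ext z ord_max = z by rewrite /ext unlift_none.
have exti z (i : 'I_k) : ext z (widen_ord (leqnSn k) i) = w i.
  have -> : widen_ord (leqnSn k) i = lift ord_max i.
    by apply: val_inj; rewrite /= /bump leqNgt ltn_ord.
  by rewrite /ext liftK.
pose extX (i : 'I_k.+1) := if unlift ord_max i is Some j then (w j)%:P else 'X.
pose q : {poly K} := \sum_(m <- msupp F1) F1@_m *: \prod_i extX i ^+ m i.
have qE z : q.[z] = F1.@[ext z].
  rewrite horner_sum mevalE; apply: eq_bigr => m _; rewrite hornerZ horner_prod.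
  congr (_ * _); apply: eq_bigr => i _; rewrite horner_exp /ext /extX.
  by case: unlift => [j|]; rewrite ?hornerC ?hornerX.
have nz : (F0'.@[w])%:P + 'X * q != 0.
  apply/eqP => /(congr1 (fun p => p.[0])) /eqP.
  by rewrite hornerD hornerM hornerX mul0r addr0 hornerC horner0 (negPf Fw).
have [z z0 Pz] := exists_nonzero_nonroot Kinf nz.
exists (ext z); rewrite FE extm mulf_neq0 ?expf_neq0 // -qE.
by move: Pz; rewrite hornerD hornerM hornerX hornerC (meval_eq _ (exti z)).
Qed.

(** F0 is the homogeneous part of lowest degree e. Along a curve z * Y(z) through
    the origin it is the leading term of F. *)
Lemma mpoly_lowest_part (K : fieldType) k (F : {mpoly K[k]}) : F != 0 ->
  exists (e : nat) (F0 : {mpoly K[k]}), F0 != 0 /\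
    forall Y : 'I_k -> {poly K}, exists Q : {poly K},
      Q.[0] = F0.@[fun j => (Y j).[0]] /\
      forall z, F.@[fun j => z * (Y j).[z]] = z ^+ e * Q.[z].
Proof.
move=> F0.
have [m0 m0F min0] := msupp_min (@mdeg k) F0.
pose e := mdeg m0.
pose G := \sum_(m <- msupp F | mdeg m == e) F@_m *: 'X_[m] : {mpoly K[k]}.
exists e, G; split.
  apply/eqP => /(congr1 (mcoeff m0)) /eqP.
  rewrite mcoeff0 /G raddf_sum /= big_mkcond (bigD1_seq m0) ?msupp_uniq //= eqxx.
  rewrite big1 ?addr0; last first.
    by move=> m mm0; case: ifP => // _; rewrite mcoeffZ mcoeffX (negPf mm0) mulr0.
  by rewrite mcoeffZ mcoeffX eqxx mulr1 -[_ == 0]negbK -mcoeff_msupp m0F.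
move=> Y; exists (\sum_(m <- msupp F) F@_m *: ('X ^+ (mdeg m - e) * \prod_i Y i ^+ m i)).
split.
  rewrite horner_sum /G raddf_sum [RHS]big_mkcond /=.
  rewrite big_seq [RHS]big_seq; apply: eq_bigr => m mF.
  rewrite hornerZ hornerM horner_exp hornerX expr0n subn_eq0 horner_prod.
  rewrite eqn_leq min0 // andbT; case: leqP => _; last by rewrite mul0r mulr0.
  rewrite mul1r mevalZ mevalX; congr (_ * _).
  by apply: eq_bigr => i _; rewrite horner_exp.
move=> z; rewrite mevalE horner_sum big_distrr /= big_seq [RHS]big_seq.
apply: eq_bigr => m mF; rewrite hornerZ hornerM horner_exp hornerX horner_prod mulrCA.
congr (_ * _); rewrite mulrA -exprD subnKC ?min0 //.
rewrite mdegE expr_sum -big_split /=.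
by apply: eq_bigr => i _; rewrite exprMn horner_exp.
Qed.

(** * Polynomial functions and algebraic dependence *)

Definition polyfun (K : fieldType) k (f : 'rV[K]_k -> K) : Prop :=
  exists p : {mpoly K[k]}, forall x, f x = p.@[x 0].

Definition polymap (K : fieldType) k n (phi : 'rV[K]_k -> 'M[K]_n) : Prop :=
  forall i j, polyfun (fun x => phi x i j).

Section PolynomialFunctions.
Context (K : fieldType).

Lemma polyfun_const k (c : K) : polyfun (fun _ : 'rV[K]_k => c).
Proof. by exists c%:MP => x; rewrite mevalC. Qed.

Lemma polyfun_coord k (i : 'I_k) : polyfun (fun x : 'rV[K]_k => x 0 i).
Proof. by exists 'X_i => x; rewrite mevalXU. Qed.

Lemma polyfunD k (f g : 'rV[K]_k -> K) :
  polyfun f -> polyfun g -> polyfun (fun x => f x + g x).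
Proof. by move=> [p pE] [q qE]; exists (p + q) => x; rewrite mevalD pE qE. Qed.

Lemma polyfunM k (f g : 'rV[K]_k -> K) :
  polyfun f -> polyfun g -> polyfun (fun x => f x * g x).
Proof. by move=> [p pE] [q qE]; exists (p * q) => x; rewrite mevalM pE qE. Qed.

Lemma polyfun_sum k (I : Type) (r : seq I) (P : pred I) (f : I -> 'rV[K]_k -> K) :
  (forall i, polyfun (f i)) -> polyfun (fun x => \sum_(i <- r | P i) f i x).
Proof.
move=> pf; elim: r => [|i r IH].
  rewrite (_ : (fun _ => _) = fun=> 0); first exact: polyfun_const.
  by apply/funext => x; rewrite big_nil.
case Pi : (P i).
  rewrite (_ : (fun _ => _) = fun x => f i x + \sum_(i <- r | P i) f i x).
    exact: polyfunD.
  by apply/funext => x; rewrite big_cons Pi.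
by congr (polyfun _): IH; apply/funext => x; rewrite big_cons Pi.
Qed.

Lemma polyfun_prod k (I : Type) (r : seq I) (f : I -> 'rV[K]_k -> K) :
  (forall i, polyfun (f i)) -> polyfun (fun x => \prod_(i <- r) f i x).
Proof.
move=> pf; elim: r => [|i r IH].
  rewrite (_ : (fun _ => _) = fun=> 1); first exact: polyfun_const.
  by apply/funext => x; rewrite big_nil.
rewrite (_ : (fun _ => _) = fun x => f i x * \prod_(i <- r) f i x).
  exact: polyfunM.
by apply/funext => x; rewrite big_cons.
Qed.

Lemma polyfun_meval k l (p : {mpoly K[l]}) (g : 'I_l -> 'rV[K]_k -> K) :
  (forall j, polyfun (g j)) -> polyfun (fun x => p.@[fun j => g j x]).
Proof.
move=> pg; have [G GE] := fin_all_exists pg.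
exists (p \mPo [tuple G j | j < l]) => x; rewrite comp_mpoly_meval.
by apply: meval_eq => j; rewrite tnth_mktuple.
Qed.

Lemma polyfun_comp k l (f : 'rV[K]_l -> K) (h : 'rV[K]_k -> 'rV[K]_l) :
  polyfun f -> (forall j, polyfun (fun x => h x 0 j)) ->
  polyfun (fun x => f (h x)).
Proof.
move=> [p pE] ph; have [q qE] := polyfun_meval p ph.
by exists q => x; rewrite pE qE.
Qed.

Lemma polymap_linear k n (f : {linear 'rV[K]_k -> 'M[K]_n}) : polymap f.
Proof.
move=> a b; rewrite (_ : (fun _ => _) = fun x : 'rV[K]_k => \sum_j x 0 j * f (delta_mx 0 j) a b).
  apply: polyfun_sum => j; apply: polyfunM; [exact: polyfun_coord|exact: polyfun_const].
apply/funext => x; rewrite [in LHS](row_sum_delta x) linear_sum summxE.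
by apply: eq_bigr => j _; rewrite linearZ mxE.
Qed.

Lemma polymap_const k n (A : 'M[K]_n) : polymap (fun _ : 'rV[K]_k => A).
Proof. by move=> a b; exact: polyfun_const. Qed.

Lemma polymapD k n (f g : 'rV[K]_k -> 'M[K]_n) :
  polymap f -> polymap g -> polymap (fun x => f x + g x).
Proof.
move=> pf pg a b; congr (polyfun _): (polyfunD (pf a b) (pg a b)).
by apply/funext => x; rewrite mxE.
Qed.

Lemma polymapM k n (f g : 'rV[K]_k -> 'M[K]_n) :
  polymap f -> polymap g -> polymap (fun x => f x *m g x).
Proof.
move=> pf pg a b.
rewrite (_ : (fun _ => _) = fun x => \sum_j f x a j * g x j b).
  by apply: polyfun_sum => j; apply: polyfunM; [exact: pf|exact: pg].
by apply/funext => x; rewrite mxE.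
Qed.

Lemma polymap_comp k l n (phi : 'rV[K]_l -> 'M[K]_n)
    (h : 'rV[K]_k -> 'rV[K]_l) :
  polymap phi -> (forall j, polyfun (fun x => h x 0 j)) ->
  polymap (fun x => phi (h x)).
Proof. by move=> pphi ph a b; exact: polyfun_comp (pphi a b) ph. Qed.

Lemma polymap_prod k n r (f : 'I_r -> 'rV[K]_k -> 'M[K]_n) :
  (forall i, polymap (f i)) ->
  polymap (fun x => \big[mulmx/1%:M]_(i < r) f i x).
Proof.
move=> pf; elim: (index_enum _) => [|i s IH].
  rewrite (_ : (fun _ => _) = fun=> 1%:M); first exact: polymap_const.
  by apply/funext => x; rewrite big_nil.
rewrite (_ : (fun _ => _) = fun x => f i x *m \big[mulmx/1%:M]_(i <- s) f i x).
  exact: polymapM.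
by apply/funext => x; rewrite big_cons.
Qed.

Lemma polyfun_mxeval k n (p : {mpoly K[n * n]}) (phi : 'rV[K]_k -> 'M[K]_n) :
  polymap phi -> polyfun (fun x => p.@[mxvec (phi x) 0]).
Proof.
move=> pphi; apply: (polyfun_meval p (g := fun j x => mxvec (phi x) 0 j)) => j.
by case/mxvec_indexP: j => a b; congr (polyfun _): (pphi a b); apply/funext => x; rewrite mxvecE.
Qed.

(** If a product of polynomial functions vanishes, so does a factor. This gives
    both the irreducibility of images of polynomial maps and density arguments. *)
Lemma polyfun_domain k (f g : 'rV[K]_k -> K) : infinite_field K ->
  polyfun f -> polyfun g -> (forall x, f x * g x = 0) ->
  (forall x, f x = 0) \/ (forall x, g x = 0).
Proof.
move=> Kinf [p pE] [q qE] fg0.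
have [p0|p0] := eqVneq p 0; first by left => x; rewrite pE p0 meval0.
have [q0|q0] := eqVneq q 0; first by right => x; rewrite qE q0 meval0.
have [v /eqP[]] := mpoly_exists_nonroot Kinf (mulf_neq0 p0 q0).
have := fg0 (\row_i v i); rewrite pE qE -mevalM => <-.
by apply: meval_eq => i; rewrite mxE.
Qed.

Lemma msize_prod_exp_le k d (G : 'I_k -> {mpoly K[d]}) (a : 'I_k -> nat) e D :
  (forall j, msize (G j) <= e.+1)%N -> (forall j, a j <= D)%N ->
  (msize (\prod_j G j ^+ a j) <= (k * (D * e)).+1)%N.
Proof.
move=> Ge aD.
have mul (p q : {mpoly K[d]}) s t : (msize p <= s.+1 -> msize q <= t.+1 ->
    msize (p * q)%R <= (s + t).+1)%N.
  have [->|p0] := eqVneq p 0; first by rewrite mul0r msize0.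
  have [->|q0] := eqVneq q 0; first by rewrite mulr0 msize0.
  move=> ps qt; rewrite msizeM //.
  by rewrite -subn1 leq_subLR; apply: leq_trans (leq_add ps qt) _; rewrite addSn addnS add1n.
have exp (p : {mpoly K[d]}) s t : (msize p <= s.+1 -> msize (p ^+ t)%R <= (t * s).+1)%N.
  by move=> ps; elim: t => [|t IH]; rewrite ?expr0 ?msize1 // exprS mulSn mul.
have -> : (k * (D * e) = \sum_(j < k) (D * e))%N by rewrite sum_nat_const card_ord.
elim/big_ind2: _ => [|p s q t|j _]; rewrite ?msize1 //.
  exact: mul.
by apply: leq_trans (exp _ _ _ (Ge j)) _; rewrite ltnS leq_mul2r aD orbT.
Qed.

(** The monomials in the G j with exponents at most D are (D + 1)^k in number and
    lie in a space whose dimension grows like D^d. For large D they are linearly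
    dependent, and the coefficients of a linear relation are those of F. *)
Lemma mpoly_alg_dep k d (G : 'I_k -> {mpoly K[d]}) : (d < k)%N ->
  exists2 F : {mpoly K[k]}, F != 0 & F \mPo [tuple G j | j < k] = 0.
Proof.
move=> dk.
pose e := \max_j msize (G j).
have Ge j : (msize (G j) <= e.+1)%N by apply: leqW; exact: leq_bigmax.
(* With c as below, c <= (k * e).+1 * D.+1, so that c ^ d < D.+1 ^ d.+1. *)
pose D := ((k * e).+1 ^ d)%N.
pose c := (k * (D * e)).+1.
pose mon (a : {ffun 'I_k -> 'I_D.+1}) := \prod_j G j ^+ a j.
have monc a : (msize (mon a) <= c)%N.
  by apply: msize_prod_exp_le => // j; rewrite -ltnS.
pose M : 'M[K]_(#|{: {ffun 'I_k -> 'I_D.+1}}|, #|{: 'X_{1..d < c}}|) :=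
  \matrix_(a, b) (mon (enum_val a))@_(bmnm (enum_val b : 'X_{1..d < c})).
have cardX : (#|{: 'X_{1..d < c}}| <= c ^ d)%N.
  rewrite -[X in (_ <= X ^ _)%N](card_ord c) -[d in (_ ^ d)%N]card_ord -card_ffun.
  have lt (m : 'X_{1..d < c}) i : (m i < c)%N.
    by apply: leq_ltn_trans (bmdeg m); rewrite mdegE (bigD1 i) //= leq_addr.
  apply: (leq_card (fun m : 'X_{1..d < c} => [ffun i => Ordinal (lt m i)])).
  move=> m m' /ffunP E; apply/val_inj/mnmP => i.
  by have /(congr1 val) := E i; rewrite !ffunE.
have big : (c ^ d < D.+1 ^ k)%N.
  apply: (@leq_trans (D.+1 ^ d.+1)); last by rewrite leq_pexp2l.
  rewrite expnS; apply: (@leq_ltn_trans (((k * e).+1 * D.+1) ^ d)).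
    case: (d) => [|d'] //; rewrite leq_exp2r // /c.
    by rewrite mulSn mulnS (mulnC D e) mulnA -add1n leq_add // leq_addl.
  by rewrite expnMn ltn_pmul2r // expn_gt0.
have kerM : kermx M != 0.
  rewrite -mxrank_eq0 mxrank_ker subn_eq0 -ltnNge.
  apply: leq_ltn_trans (rank_leq_col _) _.
  by apply: leq_ltn_trans cardX _; rewrite card_ffun !card_ord.
have /rowV0Pn[u] := kerM.
move=> /sub_kermxP uM u0.
pose F : {mpoly K[k]} := \sum_a u 0 a *: 'X_[[multinom val (enum_val a j) | j < k]].
exists F.
  have /rV0Pn[a ua] := u0; apply: contra ua => /eqP F0.
  have /eqP := congr1 (mcoeff [multinom val (enum_val a j) | j < k]) F0.
  rewrite mcoeff0 raddf_sum /= (bigD1 a) //= mcoeffZ mcoeffX eqxx mulr1.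
  rewrite big1 ?addr0 // => b ba; rewrite mcoeffZ mcoeffX.
  case: eqP => [/mnmP E|]; last by rewrite mulr0.
  case/eqP: ba; apply: enum_val_inj; apply/ffunP => j; apply: val_inj.
  by have := E j; rewrite !mnmE.
have FE : F \mPo [tuple G j | j < k] = \sum_a u 0 a *: mon (enum_val a).
  rewrite raddf_sum; apply: eq_bigr => a _ /=; rewrite comp_mpolyZ comp_mpolyX.
  by congr (_ *: _); apply: eq_bigr => j _; rewrite tnth_mktuple mnmE.
rewrite FE; apply/mpolyP => m; rewrite mcoeff0 raddf_sum /=.
have [mc|mc] := ltnP (mdeg m) c; last first.
  rewrite big1 // => a _; rewrite mcoeffZ.
  suff -> : (mon (enum_val a))@_m = 0 by rewrite mulr0.
  by apply/eqP; rewrite mcoeff_eq0; apply: msize_mdeg_ge; exact: leq_trans (monc _) mc.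
have /matrixP/(_ 0 (enum_rank (BMultinom mc))) := uM; rewrite !mxE => h; rewrite -[RHS]h.
by apply: eq_bigr => a _; rewrite mcoeffZ mxE enum_rankK.
Qed.

Lemma polyfun_alg_dep k d (g : 'I_k -> 'rV[K]_d -> K) :
  (d < k)%N -> (forall j, polyfun (g j)) ->
  exists2 F : {mpoly K[k]}, F != 0 & forall x, F.@[fun j => g j x] = 0.
Proof.
move=> dk pg; have [G GE] := fin_all_exists pg.
have [F F0 FG] := mpoly_alg_dep G dk; exists F => // x.
rewrite -[RHS](meval0 (x 0)) -FG comp_mpoly_meval.
by apply: meval_eq => j; rewrite tnth_mktuple.
Qed.

End PolynomialFunctions.

(** * Zariski closures and chains of irreducible closed sets *)

Section Zariski.
Context (K : fieldType) (n : nat).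
Implicit Types (S X Z : set 'M[K]_n) (p q : {mpoly K[n * n]}).

Definition vanishes_on p S := forall A, S A -> p.@[mxvec A 0] = 0.

Lemma zariski_closureE S :
  zariski_closure S = zero_locus [set p | vanishes_on p S].
Proof.
apply/seteqP; split=> A.
  apply; split; first by exists [set p | vanishes_on p S].
  by move=> B SB p; apply.
move=> zA _ [[I ->] SI] p Ip; apply: zA => B SB.
exact: (SI B SB).
Qed.

Lemma zariski_closed_closure S : zariski_closed (zariski_closure S).
Proof. by rewrite zariski_closureE; eexists. Qed.

Lemma sub_zariski_closure S : S `<=` zariski_closure S.
Proof. exact: sub_smallest. Qed.

Lemma zariski_closure_min S Z :
  zariski_closed Z -> S `<=` Z -> zariski_closure S `<=` Z.
Proof. by move=> cZ SZ; apply: smallest_sub. Qed.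

Lemma vanishes_on_closure p S : vanishes_on p S -> vanishes_on p (zariski_closure S).
Proof. by move=> pS A; rewrite zariski_closureE; apply. Qed.

Lemma zariski_closedI X Y : zariski_closed X -> zariski_closed Y ->
  zariski_closed (X `&` Y).
Proof.
move=> [I ->] [J ->]; exists (I `|` J); apply/seteqP; split=> A.
  by move=> [AI AJ] p [/AI|/AJ].
by move=> AIJ; split=> p ?; apply: AIJ; [left|right].
Qed.

Lemma zariski_closed_poly p : zariski_closed [set A : 'M[K]_n | p.@[mxvec A 0] = 0].
Proof.
exists [set p]; apply/seteqP; split=> A; first by move=> pA q ->.
exact.
Qed.

Lemma irreducible_vanishes p q X : irreducible_closed X ->
  vanishes_on (p * q) X -> vanishes_on p X \/ vanishes_on q X.
Proof.
move=> [cX _ irr] pqX.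
have := irr _ _ (zariski_closedI cX (zariski_closed_poly p))
             (zariski_closedI cX (zariski_closed_poly q)).
case.
- apply/seteqP; split=> A.
    move=> XA; have /eqP := pqX A XA; rewrite mevalM mulf_eq0 => /orP[]/eqP; [left|right]; by split.
  by case=> -[].
- by move=> E; left=> A; rewrite E => -[].
- by move=> E; right=> A; rewrite E => -[].
Qed.

(** If p and q vanish on two closed sets that cover the image, then the product of
    the pullbacks of p and q vanishes on the parameter space. *)
Lemma irreducible_closure_image k (phi : 'rV[K]_k -> 'M[K]_n) :
  infinite_field K -> polymap phi ->
  irreducible_closed (zariski_closure (range phi)).
Proof.
move=> Kinf pphi; split; first exact: zariski_closed_closure.
  by exists (phi 0); apply: sub_zariski_closure; exists 0.
move=> _ _ [I ->] [J ->] E.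
have incl (L : set {mpoly K[n * n]}) : zero_locus L `<=` zariski_closure (range phi) ->
    (forall p, L p -> forall x, p.@[mxvec (phi x) 0] = 0) ->
    zariski_closure (range phi) = zero_locus L.
  move=> sub van; apply/seteqP; split=> //.
  by apply: zariski_closure_min; [eexists|move=> _ [x _ <-] p /van].
have [vI|] := pselect (forall p, I p -> forall x, p.@[mxvec (phi x) 0] = 0).
  by left; apply: incl => //; rewrite E; exact: subsetUl.
move=> nI; right; apply: incl; first by rewrite E; exact: subsetUr.
move=> q Jq.
apply: contrapT => nq; apply: nI => p Ip.
have [//|//] : (forall x, p.@[mxvec (phi x) 0] = 0) \/ (forall x, q.@[mxvec (phi x) 0] = 0).
apply: polyfun_domain => //; [exact: polyfun_mxeval|exact: polyfun_mxeval|].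
move=> x; have : zariski_closure (range phi) (phi x) by apply: sub_zariski_closure; exists x.
by rewrite E => -[/(_ p Ip)|/(_ q Jq)] ->; rewrite ?mul0r ?mulr0.
Qed.

Definition alg_indep_on k (g : 'I_k -> {mpoly K[n * n]}) S :=
  forall F : {mpoly K[k]},
    (forall A, S A -> F.@[fun j => (g j).@[mxvec A 0]] = 0) -> F = 0.

(** In a relation F between the g i and f on X, powers of f can be cancelled since
    X is irreducible. What remains restricts on Z, where f = 0, to the nonzero
    relation F0 between the g i. *)
Lemma alg_indep_step k (g : 'I_k -> {mpoly K[n * n]}) f X Z :
  irreducible_closed X -> Z `<=` X -> alg_indep_on g Z ->
  vanishes_on f Z -> ~ vanishes_on f X ->
  alg_indep_on (fun j : 'I_k.+1 => if unlift ord_max j is Some i then g i else f) X.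
Proof.
move=> irrX ZX gZ fZ fX F FX; apply/eqP; apply: contrapT => /negP F0.
have [e [F0' [F1 [/eqP F0'0 FE]]]] := mpoly_split_last F0.
pose h j := if unlift ord_max j is Some i then g i else f.
pose P := (F0' \mPo [tuple g j | j < k]) + f * (F1 \mPo [tuple h j | j < k.+1]).
have PE A : P.@[mxvec A 0] = F0'.@[fun j => (g j).@[mxvec A 0]] +
    f.@[mxvec A 0] * F1.@[fun j => (h j).@[mxvec A 0]].
  rewrite /P mevalD mevalM !comp_mpoly_meval; congr (_ + _ * _);
    by apply: meval_eq => j; rewrite tnth_mktuple.
have fP : vanishes_on (f ^+ e * P) X.
  move=> A XA; rewrite mevalM rmorphXn /= PE -[RHS](FX A XA) FE.
  rewrite unlift_none; congr (_ * (_ + _)).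
  apply: meval_eq => j.
  have -> : widen_ord (leqnSn k) j = lift ord_max j.
    by apply: val_inj; rewrite /= /bump leqNgt ltn_ord.
  by rewrite liftK.
have PX : vanishes_on P X.
  elim: e {FE} fP => [|e IH]; first by rewrite mul1r.
  by rewrite exprS -mulrA => /(irreducible_vanishes irrX)[].
apply/F0'0/gZ => A ZA.
by have := PX A (ZX A ZA); rewrite PE fZ // mul0r addr0.
Qed.

Lemma irreducible_chain_alg_indep X k (Z : nat -> set 'M[K]_n) : irreducible_chain X k Z ->
  exists g : 'I_k -> {mpoly K[n * n]}, alg_indep_on g (Z k).
Proof.
move=> [irr prop].
suff: forall i, (i <= k)%N -> exists g : 'I_i -> {mpoly K[n * n]}, alg_indep_on g (Z i).
  exact.
elim=> [|i IH] ik.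
  have [[_ [A ZA] _] _] := irr 0%N ik.
  exists (fun=> 0) => F /(_ A ZA).
  by rewrite -[F]mpolyKC mevalC => ->; rewrite mpolyC0.
have [g gi] := IH (ltnW ik).
have [sub nsub] := prop i ik.
have [A [ZA nZA]] : exists A, Z i.+1 A /\ ~ Z i A.
  apply: contrapT => h; apply: nsub => A ZA.
  by apply: contrapT => nA; apply: h; exists A.
have [[[I ZiE] _ _] _] := irr i (ltnW ik).
have [f If fA] : exists2 f, I f & f.@[mxvec A 0] <> 0.
  apply: contrapT => h; apply: nZA; rewrite ZiE => p Ip.
  by apply: contrapT => pA; apply: h; exists p.
eexists; apply: (@alg_indep_step _ g f _ (Z i)) => //.
- by have [] := irr _ ik.
- by move=> B; rewrite ZiE; apply.
- by move=> /(_ A ZA).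
Qed.

(** The chain gives k independent polynomials on S. Since the image of psi is dense
    in S, their pullbacks by psi would satisfy a nonzero relation if d < k. *)
Lemma irreducible_chain_le S d (psi : 'rV[K]_d -> 'M[K]_n) k
    (Z : nat -> set 'M[K]_n) :
  polymap psi ->
  (forall p, vanishes_on p (range psi) -> vanishes_on p S) ->
  irreducible_chain (zariski_closure S) k Z -> (k <= d)%N.
Proof.
move=> ppsi dense ch; have [g gZ] := irreducible_chain_alg_indep ch.
rewrite leqNgt; apply/negP => dk.
have [F /eqP F0 FE] := @polyfun_alg_dep _ _ _ (fun j x => (g j).@[mxvec (psi x) 0]) dk
  (fun j => polyfun_mxeval (g j) ppsi).
apply/F0/gZ => A ZA.
have : vanishes_on (F \mPo [tuple g j | j < k]) (zariski_closure S).
  apply/vanishes_on_closure/dense => _ [x _ <-].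
  by rewrite comp_mpoly_meval -[RHS](FE x); apply: meval_eq => j; rewrite tnth_mktuple.
have [/(_ k (leqnn k))[_ ZX] _] := ch.
move=> /(_ A (ZX A ZA)); rewrite comp_mpoly_meval => h; rewrite -[RHS]h.
by apply: meval_eq => j; rewrite tnth_mktuple.
Qed.

(** The members of the chain are the closures of the images of the coordinate
    subspaces K^i of K^d. The expansion says that the functions g j o phi agree
    with the coordinates to first order, so the first i + 1 of them are independent on
    K^(i+1): the lowest homogeneous part of a relation F would vanish. On K^i
    they are dependent, since there are only i parameters. *)
Lemma exists_irreducible_chain S d (phi : 'rV[K]_d -> 'M[K]_n)
    (g : 'I_d -> {mpoly K[n * n]}) :
  infinite_field K -> polymap phi -> (forall x, S (phi x)) ->
  (forall x : 'rV[K]_d, exists Y : 'I_d -> {poly K},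
     (forall j, (Y j).[0] = x 0 j) /\
     (forall z j, (g j).@[mxvec (phi (z *: x)) 0] = z * (Y j).[z])) ->
  exists Z : nat -> set 'M[K]_n, irreducible_chain (zariski_closure S) d Z.
Proof.
move=> Kinf pphi phiS expand.
pose emb i (x : 'rV[K]_i) : 'rV[K]_d := x *m pid_mx i.
pose phi_ i (x : 'rV[K]_i) := phi (emb i x).
have pphi_ i : polymap (phi_ i).
  move=> a b; apply: (polyfun_comp (pphi a b)) => j.
  rewrite (_ : (fun _ => _) = fun x : 'rV[K]_i => \sum_l x 0 l * pid_mx i l j).
    apply: polyfun_sum => l; apply: polyfunM; [exact: polyfun_coord|exact: polyfun_const].
  by apply/funext => x; rewrite mxE.
exists (fun i => zariski_closure (range (phi_ i))); split=> i le_id.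
  split; first exact: irreducible_closure_image.
  apply: zariski_closure_min; first exact: zariski_closed_closure.
  by move=> _ [x _ <-]; exact: (sub_zariski_closure (phiS (emb i x))).
split.
  apply: zariski_closure_min; first exact: zariski_closed_closure.
  move=> _ [x _ <-]; apply: sub_zariski_closure; exists (x *m pid_mx i) => //.
  by rewrite /phi_ /emb -mulmxA mul_pid_mx (minn_idPl (leqnSn i)) (minn_idPr (leqnSn i)).
move=> sub.
pose g' (j : 'I_i.+1) := g (widen_ord le_id j).
have [F F0 FE] := @polyfun_alg_dep _ _ _ (fun j x => (g' j).@[mxvec (phi_ i x) 0]) (ltnSn i)
  (fun j => polyfun_mxeval (g' j) (pphi_ i)).
(* If the closures of the images of K^i and K^(i+1) were equal, then the relation F
   would hold on the latter too. *)
have van : vanishes_on (F \mPo [tuple g' j | j < i.+1]) (range (phi_ i.+1)).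
  move=> A rA; apply: (@vanishes_on_closure _ (range (phi_ i))).
    move=> _ [x _ <-].
    by rewrite comp_mpoly_meval -[RHS](FE x); apply: meval_eq => j; rewrite tnth_mktuple.
  exact: (sub _ (sub_zariski_closure rA)).
have [e [F0' [F0'0 low]]] := mpoly_lowest_part F0.
have [v F0v] := mpoly_exists_nonroot Kinf F0'0.
pose x : 'rV[K]_i.+1 := \row_j v j.
have [Y [Y0 YE]] := expand (emb i.+1 x).
have [Q [Q0 QE]] := low (fun j => Y (widen_ord le_id j)).
have xj j : emb i.+1 x 0 (widen_ord le_id j) = v j.
  rewrite mxE (bigD1 j) //= big1 ?addr0; first by rewrite !mxE eqxx ltn_ord mulr1.
  by move=> l lj; rewrite !mxE /= (_ : (l == j :> nat) = false) ?mulr0 //; exact: negPf.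
have Qn0 : Q != 0.
  apply/eqP => Q00; move: F0v.
  rewrite -(meval_eq _ xj) -(meval_eq _ (fun j => Y0 _)) -Q0 Q00 horner0.
  by rewrite eqxx.
have [z z0 Qz] := exists_nonzero_nonroot Kinf Qn0.
have : z ^+ e * Q.[z] != 0 by rewrite mulf_neq0 ?expf_neq0.
case/eqP; rewrite -QE.
have := van (phi_ i.+1 (z *: x)) (ex_intro2 _ _ (z *: x) I erefl).
rewrite comp_mpoly_meval => h; rewrite -[RHS]h.
by apply: meval_eq => j; rewrite tnth_mktuple /phi_ /emb -scalemxAl YE.
Qed.

End Zariski.

(** * Products of matrices from a linear space *)

Lemma mulmx_prodZ (K : fieldType) n (I : Type) (s : seq I) (c : I -> K) (N : I -> 'M[K]_n) :
  \big[mulmx/1%:M]_(i <- s) (c i *: N i) =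
  (\prod_(i <- s) c i) *: \big[mulmx/1%:M]_(i <- s) N i.
Proof.
elim: s => [|i s IH]; first by rewrite !big_nil scale1r.
by rewrite !big_cons IH -scalemxAl -scalemxAr scalerA.
Qed.

(** The first coordinates of the r factors are collected in one scalar, which saves
    r - 1 parameters. The products reached are those whose factors have nonzero
    first coordinates, a dense part of all products. *)
Lemma products_param (K : fieldType) n k r (lam : {linear 'rV[K]_(1 + k) -> 'M[K]_n}) :
  infinite_field K ->
  exists2 psi : 'rV[K]_(1 + r * k) -> 'M[K]_n, polymap psi &
    forall p, vanishes_on p (range psi) -> vanishes_on p (products r (range lam)).
Proof.
move=> Kinf.
pose unit_row (z : 'rV[K]_k) : 'rV[K]_(1 + k) := row_mx (const_mx 1) z.
pose psi (y : 'rV[K]_(1 + r * k)) : 'M[K]_n :=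
  y 0 (lshift _ 0) *: \big[mulmx/1%:M]_(i < r) lam (unit_row (row i (vec_mx (rsubmx y)))).
exists psi.
  have pprod : polymap (fun y : 'rV[K]_(1 + r * k) =>
      \big[mulmx/1%:M]_(i < r) lam (unit_row (row i (vec_mx (rsubmx y))))).
    apply: polymap_prod => i; apply: polymap_comp; first exact: polymap_linear.
    move=> j; case: (splitP j) => j' jE.
      rewrite (_ : (fun _ => _) = fun=> 1); first exact: polyfun_const.
      by apply/funext => y; rewrite (_ : j = lshift _ j') ?row_mxEl ?mxE //; apply: val_inj.
    rewrite (_ : (fun _ => _) = fun y : 'rV[K]_(1 + r * k) => y 0 (rshift 1 (mxvec_index i j'))).
      exact: polyfun_coord.
    apply/funext => y; rewrite (_ : j = rshift 1 j') ?row_mxEr ?mxE //.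
    exact: val_inj.
  move=> a b; congr (polyfun _): (polyfunM (polyfun_coord K (lshift _ 0)) (pprod a b)).
  by apply/funext => y; rewrite mxE.
move=> p ppsi _ [M [/fin_all_exists2[x _ xM] ->]].
pose rows (y : 'rV[K]_(r * (1 + k))) i : 'rV[K]_(1 + k) := row i (vec_mx y).
have prows i j : polyfun (fun y => rows y i 0 j).
  rewrite (_ : (fun _ => _) = fun y : 'rV[K]_(r * (1 + k)) => y 0 (mxvec_index i j)).
    exact: polyfun_coord.
  by apply/funext => y; rewrite !mxE.
(* f vanishes wherever h does not, because such a y comes from a point of the
   image of psi. *)
pose f y := p.@[mxvec (\big[mulmx/1%:M]_(i < r) lam (rows y i)) 0].
pose h y := \prod_(i < r) rows y i 0 (lshift _ 0).
have pf : polyfun f.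
  apply: polyfun_mxeval; apply: polymap_prod => i.
  by apply: polymap_comp; first exact: polymap_linear.
have ph : polyfun h by exact: polyfun_prod.
have fh0 y : f y * h y = 0.
  have [->|hy] := eqVneq (h y) 0; first by rewrite mulr0.
  rewrite /f; suff : range psi (\big[mulmx/1%:M]_(i < r) lam (rows y i)).
    by move/ppsi => ->; rewrite mul0r.
  pose w i := rows y i 0 (lshift _ 0).
  have w0 i : w i != 0 by apply: contra hy => /eqP wi; rewrite /h (bigD1 i) //= -/(w i) wi mul0r.
  exists (row_mx (\row__ h y) (mxvec (\matrix_i ((w i)^-1 *: rsubmx (rows y i))))) => //.
  rewrite /psi row_mxEl mxE row_mxKr mxvecK -mulmx_prodZ.
  apply: eq_bigr => i _; rewrite -linearZ /=; congr (lam _).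
  rewrite rowK /unit_row scale_row_mx scalerA (divff (w0 i)) scale1r.
  rewrite -[RHS]hsubmxK; congr row_mx.
  by apply/rowP => j; rewrite !ord1 !mxE mulr1.
have [f0|h0] := polyfun_domain Kinf pf ph fh0.
  have := f0 (mxvec (\matrix_i x i)); rewrite /f.
  congr (p.@[mxvec _ 0] = 0); apply: eq_bigr => i _.
  by rewrite /rows mxvecK rowK xM.
have /eqP := h0 (mxvec (const_mx 1)).
by rewrite /h big1 ?oner_eq0 // => i _; rewrite /rows mxvecK !mxE.
Qed.

(** * The differential of a product *)

(** A right inverse E of the matrix D of the differential gives affine functions
    on the space of matrices that agree with the coordinates to first order along phi. *)
Lemma exists_chain_of_immersion (K : fieldType) n (S : set 'M[K]_n) d
    (phi : 'rV[K]_d -> 'M[K]_n) (D : 'M[K]_(d, n * n)) :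
  infinite_field K -> polymap phi -> (forall x, S (phi x)) -> row_free D ->
  (forall x, exists H : 'M[{poly K}]_n, forall z,
     phi (z *: x) = phi 0 + z *: vec_mx (x *m D) + z ^+ 2 *: map_mx (horner_eval z) H) ->
  exists Z : nat -> set 'M[K]_n, irreducible_chain (zariski_closure S) d Z.
Proof.
move=> Kinf pphi phiS /row_freeP[E DE] expand.
pose g (j : 'I_d) : {mpoly K[n * n]} :=
  \sum_k E k j *: ('X_k - (mxvec (phi 0) 0 k)%:MP).
have gE j A : (g j).@[mxvec A 0] = (mxvec (A - phi 0) *m E) 0 j.
  rewrite raddf_sum mxE; apply: eq_bigr => k _ /=.
  by rewrite mevalZ mevalB mevalXU mevalC mulrC linearB !mxE.
apply: (exists_irreducible_chain (g := g) Kinf pphi phiS) => x.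
have [H HE] := expand x.
exists (fun j => (x 0 j)%:P + 'X * (mxvec H *m map_mx polyC E) 0 j); split=> [j|z j].
  by rewrite hornerD hornerC hornerM hornerX mul0r addr0.
rewrite gE HE -(addrA (phi 0)) addrAC subrr add0r.
rewrite linearD !linearZ /= vec_mxK mulmxDl -!scalemxAl -mulmxA DE mulmx1.
rewrite hornerD hornerC hornerM hornerX mulrDr !mxE mulrA; congr (_ + _ * _).
rewrite horner_sum; apply: eq_bigr => k _; rewrite hornerM !mxE hornerC; congr (_ * _).
by case/mxvec_indexP: k => a b; rewrite !mxvecE mxE.
Qed.

(** This makes the lemmas on iterated operators apply to products of square
    matrices of any size, zero included. *)
HB.instance Definition _ (R : pzSemiRingType) n :=
  Monoid.isLaw.Build 'M[R]_n 1%:M mulmx (@mulmxA R n n n n) (@mul1mx R n n) (@mulmx1 R n n).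

Lemma map_horner_polyC (K : fieldType) a b (z : K) (M : 'M[K]_(a, b)) :
  map_mx (horner_eval z) (map_mx polyC M) = M.
Proof. by apply/matrixP => i j; rewrite !mxE /horner_eval hornerC. Qed.

Lemma map_horner_affine (K : fieldType) n (z : K) (M : 'M[K]_n) :
  map_mx (horner_eval z) (1%:M + 'X *: map_mx polyC M) = 1%:M + z *: M.
Proof.
rewrite (map_mxD (horner_eval z)) (map_mxZ (horner_eval z)) map_mx1 map_horner_polyC.
by rewrite /= /horner_eval hornerX.
Qed.

(** The Leibniz rule: the differential at A, in the direction X, of the product of
    r factors. *)
Fixpoint dprod (R : comNzRingType) n (A X : nat -> 'M[R]_n) r : 'M[R]_n :=
  if r is r'.+1 then dprod A X r' *m A r' + (\big[mulmx/1%:M]_(i < r') A i) *m X r'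
  else 0.

Lemma prod_expand (K : fieldType) n (A X : nat -> 'M[K]_n) r :
  exists H : 'M[{poly K}]_n, forall z,
    \big[mulmx/1%:M]_(i < r) (A i + z *: X i) =
    \big[mulmx/1%:M]_(i < r) A i + z *: dprod A X r
      + z ^+ 2 *: map_mx (horner_eval z) H.
Proof.
elim: r => [|r [H HE]].
  by exists 0 => z; rewrite !big_ord0 /= scaler0 addr0 map_mx0 scaler0 addr0.
exists (map_mx polyC (dprod A X r *m X r) +
        H *m (map_mx polyC (A r) + 'X *: map_mx polyC (X r))) => z.
rewrite !big_ord_recr /= HE (map_mxD (horner_eval z)) (map_mxM (horner_eval z)).
rewrite (map_mxD (horner_eval z)) (map_mxZ (horner_eval z)) !map_horner_polyC /=.
rewrite (_ : horner_eval z 'X = z); last by rewrite /horner_eval hornerX.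
rewrite !mulmxDl !mulmxDr -!scalemxAl -!scalemxAr !scalerDr !scalerA -expr2 -!addrA.
by congr (_ + _); rewrite addrCA.
Qed.

(** The cofactor of s when the differential of the product of the 1 + s B_j is
    summed by parts in the directions u_(j+1) - u_j. It is the sum over j of
    A_0 ... A_(j-2) (u_j B_j - B_(j-1) u_j) A_(j+1) ... A_r with A_j = 1 + s B_j,
    in recursive form. *)
Fixpoint abel_tangent (R : comNzRingType) n (s : R) (B u : nat -> 'M[R]_n) r : 'M[R]_n :=
  if r is r'.+1 then
    abel_tangent s B u r' *m (1%:M + s *: B r) +
    (\big[mulmx/1%:M]_(i < r') (1%:M + s *: B i)) *m (u r *m B r - B r' *m u r)
  else 0.

(** Two neighbouring directions leave the commutator-like term
    u_j A_j - A_(j-1) u_j, in which the identity parts of A_j and A_(j-1) cancel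
    and s factors out. *)
Lemma dprod_abel (R : comNzRingType) n (s : R) (B u : nat -> 'M[R]_n) r : u 0%N = 0 ->
  dprod (fun i => 1%:M + s *: B i) (fun i => u i.+1 - u i) r.+1 =
  (\big[mulmx/1%:M]_(i < r) (1%:M + s *: B i)) *m u r.+1 + s *: abel_tangent s B u r.
Proof.
move=> u0; elim: r => [|r IH].
  by rewrite /= !big_ord0 mul0mx add0r u0 subr0 scaler0 addr0.
rewrite [LHS]/=  -[dprod _ _ r *m _ + _]/(dprod _ _ r.+1) IH big_ord_recr /=.
set P := \big[_/_]_(i < r) _; set E := abel_tangent _ _ _ _.
rewrite mulmxDl mulmxBr -scalemxAl.
have key : P *m u r.+1 *m (1%:M + s *: B r.+1) - P *m (1%:M + s *: B r) *m u r.+1 =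
    s *: (P *m (u r.+1 *m B r.+1 - B r *m u r.+1)).
  rewrite -!mulmxA -mulmxBr scalemxAr; congr (_ *m _).
  rewrite mulmxDr mulmxDl mulmx1 mul1mx scalerBr -scalemxAl -scalemxAr.
  by rewrite opprD addrACA subrr add0r.
by rewrite scalerDr -key [X in X + _ = _]addrC addrACA [X in X + _ = _]addrC -addrA.
Qed.

(** * Displacement of products of Toeplitz matrices *)

(** The diagonals are numbered by natural numbers, from the top right corner (0)
    through the main diagonal (m) to the bottom left corner (2m). *)
Definition toeplitz_mx (K : fieldType) m (c : nat -> K) : 'M[K]_m.+1 :=
  \matrix_(i, j) c (i + (m - j))%N.

(** The columns are taken in reverse order, so that the formula for products below
    is a difference of two outer products without reversals. *)
Definition shift_diff (K : fieldType) m (M : 'M[K]_m.+1) : 'M[K]_m :=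
  \matrix_(i, l) (M (lift ord0 i) (rev_ord (widen_ord (leqnSn m) l)) -
                  M (widen_ord (leqnSn m) i) (rev_ord (lift ord0 l))).

Section Displacement.
Context (K : fieldType) (m : nat).
Implicit Types (a b c : nat -> K) (M N : 'M[K]_m.+1).

Lemma shift_diffD M N : shift_diff (M + N) = shift_diff M + shift_diff N.
Proof. by apply/matrixP => i l; rewrite !mxE opprD addrACA. Qed.

Lemma shift_diffB M N i l :
  shift_diff (M - N) i l = shift_diff M i l - shift_diff N i l.
Proof. by rewrite !mxE !opprD addrACA. Qed.

Lemma shift_diff_sum r (F : 'I_r -> 'M[K]_m.+1) :
  shift_diff (\sum_i F i) = \sum_i shift_diff (F i).
Proof.
apply: (big_morph _ shift_diffD).
by apply/matrixP => i l; rewrite !mxE subrr.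
Qed.

Lemma shift_diff_toeplitz_mx c : shift_diff (toeplitz_mx m c) = 0.
Proof.
apply/matrixP => i l; rewrite !mxE /= /bump /=.
apply/eqP; rewrite subr_eq0; apply/eqP; congr c.
by have := ltn_ord i; have := ltn_ord l; lia.
Qed.

(** The two sums over the inner index agree after a shift by one, except for one
    term at each end. *)
Lemma shift_diff_mul a b (i l : 'I_m) :
  shift_diff (toeplitz_mx m a *m toeplitz_mx m b) i l =
  a (m.+1 + i)%N * b l - a i * b (m.+1 + l)%N.
Proof.
rewrite !mxE big_ord_recl [X in _ - X]big_ord_recr [X in _ - X]addrC /= !mxE opprD addrACA /=.
rewrite (_ : _ - \sum_(_ < _) _ = 0) ?addr0.
  have := ltn_ord i; have := ltn_ord l; rewrite /bump /= => lm im.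
  by congr (a _ * b _ - a _ * b _); lia.
apply/eqP; rewrite subr_eq0; apply/eqP; apply: eq_bigr => k _; rewrite !mxE /= /bump /=.
have := ltn_ord i; have := ltn_ord l; have := ltn_ord k => km lm im.
by congr (a _ * b _); lia.
Qed.

End Displacement.

(** The coefficients of the Toeplitz matrix with f above the main diagonal, g below
    it, and zero on it. *)
Definition glue (K : fieldType) m (f g : nat -> K) (t : nat) : K :=
  if (t < m)%N then f t else if t == m then 0 else g (t - m.+1)%N.

Lemma glue_lo (K : fieldType) m (f g : nat -> K) t : (t < m)%N -> glue m f g t = f t.
Proof. by rewrite /glue => ->. Qed.

Lemma glue_hi (K : fieldType) m (f g : nat -> K) t : glue m f g (m.+1 + t) = g t.
Proof.
rewrite /glue ltnNge (leq_trans (leqnSn m)) ?leq_addr //= addKn.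
by case: eqP => // E; exfalso; lia.
Qed.

Section Directions.
Context (K : fieldType) (m q : nat).
Implicit Types x y : 'rV[K]_(q * m + (1 + 2 * m)).

(** A point x of the parameter space consists of the vectors v_l of K^m for l < q
    and the coefficients of Y. The value zero outside of the range spares case
    distinctions. *)
Definition dir_coef x (l k : nat) : K :=
  if (insub l : option 'I_q, insub k : option 'I_m) is (Some a, Some b)
  then lsubmx x 0 (mxvec_index a b) else 0.

(** The matrices B_j: for j > 0 the unit vector of index 2(j-1) above the main
    diagonal and minus the unit vector of index 2(j-1) + 1 below it (zero when the
    index is not below m). *)
Definition base_dir (j : nat) : 'M[K]_m.+1 :=
  if j is j'.+1 then
    toeplitz_mx m (glue m (fun t => (t == 2 * j')%N%:R) (fun t => - (t == (2 * j').+1)%N%:R))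
  else 0.

(** The matrices u_j. The vectors above and below the main diagonal have the
    opposite parities to those of B_j, because shift_diff_mul pairs the lower
    half of one factor with the upper half of the other. *)
Definition partial_dir x (j : nat) : 'M[K]_m.+1 :=
  if j is j'.+1 then toeplitz_mx m (glue m (dir_coef x (2 * j').+1) (dir_coef x (2 * j'))) else 0.

(** The matrix Y, which is the sum of all directions X_j up to a scalar. *)
Definition total_dir x : 'M[K]_m.+1 := toeplitz_mx m (fun t => rsubmx x 0 (inord t)).

Lemma dir_coef_oversize x l k : (q <= l)%N -> dir_coef x l k = 0.
Proof. by move=> ql; rewrite /dir_coef insubF // ltnNge ql. Qed.

Lemma sum_pick s (f : nat -> K) l : (forall t, (2 * s <= t)%N -> f t = 0) ->
  \sum_(j < s) (f (2 * j)%N * (l == (2 * j)%N)%:R + f (2 * j).+1%N * (l == (2 * j).+1)%:R) = f l.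
Proof.
move=> f0; transitivity (if (l < 2 * s)%N then f l else 0); last first.
  by case: ltnP => // /f0.
elim: s {f0} => [|s IH]; first by rewrite big_ord0.
rewrite big_ord_recr IH /=.
have [->|n1] := eqVneq l (2 * s)%N.
  rewrite ltnn add0r mulr1 (_ : (_ == _ :> nat) = false) ?mulr0 ?addr0; last by lia.
  by rewrite (_ : (_ < _)%N) //; lia.
have [->|n2] := eqVneq l (2 * s).+1.
  rewrite ltnNge leqnSn /= add0r mulr0 mulr1 add0r.
  by rewrite (_ : (_ < _)%N) //; lia.
rewrite !mulr0 !addr0; congr (if _ then _ else _); lia.
Qed.

(** The products u_j B_j put the vectors v_l into the columns of the shifted
    difference, and the products B_(j-1) u_j put them into the rows, two places
    up because of the step from j to j - 1. *)
Lemma shift_diff_limit x s (i l : 'I_m) : (q <= 2 * s)%N ->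
  shift_diff (total_dir x + \sum_(j < s)
    (partial_dir x j.+1 *m base_dir j.+1 - base_dir j *m partial_dir x j.+1)) i l =
  dir_coef x l i + dir_coef x i.+2 l.
Proof.
move=> qs; rewrite shift_diffD shift_diff_toeplitz_mx add0r shift_diff_sum summxE.
have par0 k t : (2 * s <= t)%N -> dir_coef x t k = 0.
  by move=> st; rewrite dir_coef_oversize // (leq_trans qs).
under eq_bigr do rewrite shift_diffB.
rewrite big_split /=; congr (_ + _).
  rewrite -[RHS](@sum_pick s (fun t => dir_coef x t i) l); last exact: par0.
  apply: eq_bigr => j _; rewrite shift_diff_mul !glue_hi !glue_lo ?ltn_ord //.
  by rewrite mulrN opprK.
case: s qs par0 => [|s] qs par0; first by rewrite big_ord0 par0.
rewrite -[RHS](@sum_pick s (fun t => dir_coef x t.+2 l) i); last by move=> t st; apply: par0; lia.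
rewrite big_ord_recl /= mul0mx (_ : shift_diff 0 i l = 0) ?oppr0 ?add0r; last by rewrite !mxE subrr.
apply: eq_bigr => j _; rewrite /bump /= add1n shift_diff_mul !glue_hi !glue_lo ?ltn_ord //.
rewrite mulNr opprB opprK addrC mulrC addrC add0n [X in X + _]mulrC.
by congr (dir_coef _ _ _ * _ + dir_coef _ _ _ * _); lia.
Qed.

(** Iterating v_l[i] = - v_(i+2)[l] twice raises both indices by two, and v_l = 0
    for l >= m. Once v = 0, only Y is left. *)
Lemma limit_injective x s : (q <= m)%N -> (q <= 2 * s)%N ->
  total_dir x + \sum_(j < s)
    (partial_dir x j.+1 *m base_dir j.+1 - base_dir j *m partial_dir x j.+1) = 0 ->
  x = 0.
Proof.
move=> qm qs E.
have rel i l : (i < m)%N -> (l < m)%N -> dir_coef x l i + dir_coef x i.+2 l = 0.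
  move=> im lm; rewrite -(@shift_diff_limit x s (Ordinal im) (Ordinal lm)) // E.
  by rewrite !mxE subrr.
(* Induction on a bound N for m - i, which decreases in each double step. *)
have par0 N : forall i l, (i < m)%N -> (l < m)%N -> (m - i <= N)%N -> dir_coef x l i = 0.
  elim: N => [|N IH] i l im lm; first by lia.
  move=> mi; have /eqP := rel i l im lm; rewrite addr_eq0 => /eqP ->.
  have [mi2|i2m] := leqP m i.+2; first by rewrite dir_coef_oversize ?oppr0 // (leq_trans qm).
  have /eqP := rel l i.+2 lm i2m; rewrite addr_eq0 => /eqP ->.
  have [ml2|l2m] := leqP m l.+2; first by rewrite dir_coef_oversize ?oppr0 // (leq_trans qm).
  by rewrite IH ?oppr0 //; lia.
have lx : lsubmx x = 0.
  apply/rowP => k; case/mxvec_indexP: k => a b.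
  have := par0 m b a (ltn_ord b) (leq_trans (ltn_ord a) qm) (leq_subr _ _).
  by rewrite /dir_coef !valK => ->; rewrite mxE.
have parx0 l k : dir_coef x l k = 0.
  rewrite /dir_coef; case: (insub l : option 'I_q) => [a|//].
  by case: (insub k : option 'I_m) => [b|//]; rewrite lx mxE.
have U0 j : partial_dir x j = 0.
  case: j => // j; apply/matrixP => a b; rewrite !mxE /glue !parx0.
  by case: ifP => // _; case: ifP.
move: E; rewrite big1 ?addr0 => [Y0|j _]; last by rewrite !U0 mul0mx mulmx0 subrr.
rewrite -[x]hsubmxK lx; suff -> : rsubmx x = 0 by rewrite row_mx0.
apply/rowP => t; have tm : (t < (2 * m).+1)%N by exact: ltn_ord t.
have /matrixP/(_ (inord (t - m)) (inord (m - t))) := Y0; rewrite mxE.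
rewrite [inord (_ + _)](_ : _ = t) ?mxE //.
by apply: val_inj; rewrite /= !inordK; lia.
Qed.

End Directions.

(** * Linear families of tangent vectors *)

Section LinearMaps.
Context (K : fieldType) (d n : nat).
Implicit Types f g : 'rV[K]_d -> 'M[K]_n.

Lemma linear_mapB f g : linear f -> linear g -> linear (fun x => f x - g x).
Proof. by move=> lf lg a x y; rewrite lf lg scalerBr opprD addrACA. Qed.

Lemma linear_mapD f g : linear f -> linear g -> linear (fun x => f x + g x).
Proof. by move=> lf lg a x y; rewrite lf lg scalerDr addrACA. Qed.

Lemma linear_mulmxl (A : 'M[K]_n) f : linear f -> linear (fun x => A *m f x).
Proof. by move=> lf a x y; rewrite lf mulmxDr -scalemxAr. Qed.

Lemma linear_mulmxr (A : 'M[K]_n) f : linear f -> linear (fun x => f x *m A).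
Proof. by move=> lf a x y; rewrite lf mulmxDl -scalemxAl. Qed.

Lemma linear_mx_map f : linear f ->
  exists F : {linear 'rV[K]_d -> 'M[K]_n}, f =1 F.
Proof.
move=> lf.
pose F : {linear 'rV[K]_d -> 'M[K]_n} := HB.pack f (GRing.isLinear.Build _ _ _ _ f lf).
by exists F.
Qed.

Lemma linear_mapZ f a x : linear f -> f (a *: x) = a *: f x.
Proof. by move=> /linear_mx_map[F fE]; rewrite !fE linearZ. Qed.

Lemma polymap_of_linear f : linear f -> polymap f.
Proof. by move=> /linear_mx_map[F /funext ->]; exact: polymap_linear. Qed.

Definition lin_matrix f : 'M[K]_(d, n * n) := \matrix_i mxvec (f (delta_mx 0 i)).

Lemma mul_lin_matrix f x : linear f -> x *m lin_matrix f = mxvec (f x).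
Proof.
move=> /linear_mx_map[F fE]; rewrite mulmx_sum_row fE [in RHS](row_sum_delta x) !linear_sum /=.
by apply: eq_bigr => i _; rewrite rowK fE !linearZ.
Qed.

Lemma row_free_lin_matrix f : linear f -> (forall x, f x = 0 -> x = 0) -> row_free (lin_matrix f).
Proof.
move=> lf inj; rewrite -kermx_eq0; apply/rowV0P => v /sub_kermxP.
rewrite mul_lin_matrix // => /eqP; rewrite -[X in _ == X](linear0 mxvec) (inj_eq (can_inj mxvecK)).
by move=> /eqP /inj.
Qed.

End LinearMaps.

(** If E is a right inverse of the matrix at s = 0, then the determinant of its
    product with E is a polynomial in s with value 1 at 0, so it is nonzero at some
    nonzero s. *)
Lemma row_free_specialize (K : fieldType) d N (D : 'M[{poly K}]_(d, N)) :
  infinite_field K -> row_free (map_mx (horner_eval 0) D) ->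
  exists2 s, s != 0 & row_free (map_mx (horner_eval s) D).
Proof.
move=> Kinf /row_freeP[E DE].
have ev s : (\det (D *m map_mx polyC E)).[s] = \det (map_mx (horner_eval s) D *m E).
  by rewrite -/(horner_eval s _) -det_map_mx map_mxM (map_horner_polyC s).
have nz : \det (D *m map_mx polyC E) != 0.
  apply/eqP => h; have := ev 0; rewrite h DE det1 horner0 => /eqP.
  by rewrite eq_sym oner_eq0.
have [s s0 ds] := exists_nonzero_nonroot Kinf nz; exists s => //.
move: ds; rewrite ev -unitfE -[_ \is a _]/(_ \in unitmx) => u.
apply/row_freeP; exists (E *m invmx (map_mx (horner_eval s) D *m E)).
by rewrite mulmxA mulmxV.
Qed.

Section Tangent.
Context (K : fieldType) (n : nat).

Lemma abel_tangent_linear d s (B : nat -> 'M[K]_n) (u : 'rV[K]_d -> nat -> 'M[K]_n) r :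
  (forall j, linear (u^~ j)) -> linear (fun x => abel_tangent s B (u x) r).
Proof.
move=> lu; elim: r => [|r IH] /=; first by move=> a x y; rewrite scaler0 addr0.
apply: linear_mapD; first exact: linear_mulmxr.
apply: linear_mulmxl; apply: linear_mapB; first exact: linear_mulmxr.
exact: linear_mulmxl.
Qed.

Lemma abel_tangent_ext s (B u v : nat -> 'M[K]_n) r :
  (forall j, (j <= r)%N -> u j = v j) -> abel_tangent s B u r = abel_tangent s B v r.
Proof.
elim: r => [|r IH] //= uv; rewrite IH ?uv // => j jr; apply: uv; exact: leqW.
Qed.

Lemma abel_tangent0 (B u : nat -> 'M[K]_n) r :
  abel_tangent 0 B u r = \sum_(j < r) (u j.+1 *m B j.+1 - B j *m u j.+1).
Proof.
elim: r => [|r IH]; first by rewrite big_ord0.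
rewrite big_ord_recr /= -IH scale0r addr0 mulmx1; congr (_ + _).
rewrite big1 ?mul1mx // => i _.
by rewrite scale0r addr0.
Qed.

Lemma map_prod_affine z (B : nat -> 'M[K]_n) r :
  map_mx (horner_eval z) (\big[mulmx/1%:M]_(i < r) (1%:M + 'X *: map_mx polyC (B i))) =
  \big[mulmx/1%:M]_(i < r) (1%:M + z *: B i).
Proof.
elim: r => [|r IH]; first by rewrite !big_ord0 map_mx1.
by rewrite !big_ord_recr /= (map_mxM (horner_eval z)) IH map_horner_affine.
Qed.

Lemma map_abel_tangent z (B u : nat -> 'M[K]_n) r :
  map_mx (horner_eval z) (abel_tangent 'X (fun j => map_mx polyC (B j))
     (fun j => map_mx polyC (u j)) r) = abel_tangent z B u r.
Proof.
elim: r => [|r IH]; first by rewrite /= map_mx0.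
rewrite /= (map_mxD (horner_eval z)) !(map_mxM (horner_eval z)) IH.
rewrite map_horner_affine map_prod_affine.
by rewrite (map_mxB (horner_eval z)) !(map_mxM (horner_eval z)) !map_horner_polyC.
Qed.

End Tangent.

Lemma toeplitz_mxP (K : fieldType) m c : toeplitz (toeplitz_mx m c : 'M[K]_m.+1).
Proof.
move=> i j i' j' E; rewrite !mxE; congr c.
by have := ltn_ord i; have := ltn_ord j; have := ltn_ord i'; have := ltn_ord j'; lia.
Qed.

Lemma toeplitz0 (K : fieldType) n : toeplitz (0 : 'M[K]_n).
Proof. by move=> i j i' j' _; rewrite !mxE. Qed.

Lemma toeplitz1 (K : fieldType) n : toeplitz (1%:M : 'M[K]_n).
Proof. by move=> i j i' j' E; rewrite !mxE -!val_eqE /=; congr (_%:R); lia. Qed.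

Lemma toeplitz_lin (K : fieldType) n (a : K) (A B : 'M[K]_n) :
  toeplitz A -> toeplitz B -> toeplitz (a *: A + B).
Proof. by move=> tA tB i j i' j' E; rewrite !mxE (tA _ _ _ _ E) (tB _ _ _ _ E). Qed.

Lemma toeplitzB (K : fieldType) n (A B : 'M[K]_n) :
  toeplitz A -> toeplitz B -> toeplitz (A - B).
Proof. by move=> tA tB; rewrite addrC -scaleN1r; exact: toeplitz_lin. Qed.

Lemma base_dir_toeplitz (K : fieldType) m j : toeplitz (base_dir K m j).
Proof. by case: j => [|j]; [exact: toeplitz0|exact: toeplitz_mxP]. Qed.

Lemma partial_dir_toeplitz (K : fieldType) m q (x : 'rV[K]_(q * m + (1 + 2 * m))) j :
  toeplitz (partial_dir x j).
Proof. by case: j => [|j]; [exact: toeplitz0|exact: toeplitz_mxP]. Qed.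

Lemma dir_coef_linear (K : fieldType) m q (a : K) (x y : 'rV[K]_(q * m + (1 + 2 * m))) l k :
  dir_coef (a *: x + y) l k = a * dir_coef x l k + dir_coef y l k.
Proof.
rewrite /dir_coef; case: (insub l : option 'I_q) => [b|]; last by rewrite mulr0 addr0.
by case: (insub k : option 'I_m) => [c|]; rewrite ?mulr0 ?addr0 // linearP !mxE.
Qed.

Lemma partial_dir_linear (K : fieldType) m q j :
  linear (fun x : 'rV[K]_(q * m + (1 + 2 * m)) => partial_dir x j).
Proof.
move=> a x y; case: j => [|j]; first by rewrite /= scaler0 addr0.
apply/matrixP => b c; rewrite !mxE /glue !dir_coef_linear.
by case: ifP => // _; case: ifP => // _; rewrite mulr0 addr0.
Qed.

Lemma total_dir_linear (K : fieldType) m q :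
  linear (fun x : 'rV[K]_(q * m + (1 + 2 * m)) => total_dir x).
Proof. by move=> a x y; apply/matrixP => b c; rewrite !mxE. Qed.

(** * Chains in varieties of Toeplitz products *)

Section LowerBound.
Context (K : fieldType) (m q r : nat) (Q : 'M[K]_m.+1).

(** The differential of the product divided by s, times a fixed matrix Q: the
    identity for Toeplitz factors, and for Hankel factors possibly the exchange
    matrix. *)
Definition tangent (s : K) (x : 'rV[K]_(q * m + (1 + 2 * m))) : 'M[K]_m.+1 :=
  ((\big[mulmx/1%:M]_(i < r) (1%:M + s *: base_dir K m i)) *m total_dir x
    + abel_tangent s (base_dir K m) (partial_dir x) r) *m Q.

Lemma tangent_linear s : linear (tangent s).
Proof.
apply: linear_mulmxr; apply: linear_mapD.
  by apply: linear_mulmxl; exact: total_dir_linear.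
by apply: abel_tangent_linear => j; exact: partial_dir_linear.
Qed.

Lemma exists_injective_tangent : infinite_field K -> Q \in unitmx ->
  (q <= m)%N -> (q <= 2 * r)%N ->
  exists2 s, s != 0 & row_free (lin_matrix (tangent s)).
Proof.
move=> Kinf Qu qm qr.
pose P (M : 'M[K]_m.+1) : 'M[{poly K}]_m.+1 := map_mx polyC M.
pose D : 'M[{poly K}]_(q * m + (1 + 2 * m), m.+1 * m.+1) := \matrix_i mxvec
  (((\big[mulmx/1%:M]_(j < r) (1%:M + 'X *: P (base_dir K m j))) *m P (total_dir (delta_mx 0 i))
   + abel_tangent 'X (fun j => P (base_dir K m j))
       (fun j => P (partial_dir (delta_mx 0 i) j)) r) *m P Q).
have DE s : map_mx (horner_eval s) D = lin_matrix (tangent s).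
  apply/row_matrixP => i; rewrite -map_row !rowK map_mxvec; congr mxvec.
  rewrite (map_mxM (horner_eval s)) (map_mxD (horner_eval s)) (map_mxM (horner_eval s)).
  by rewrite map_prod_affine map_abel_tangent !map_horner_polyC.
have [|s s0] := @row_free_specialize _ _ _ D Kinf; last by rewrite DE; exists s.
rewrite DE; apply: row_free_lin_matrix; first exact: tangent_linear.
move=> x; rewrite /tangent => /(congr1 (mulmx^~ (invmx Q))).
rewrite mulmxK // mul0mx abel_tangent0 big1 ?mul1mx; last by move=> i _; rewrite scale0r addr0.
exact: limit_injective.
Qed.

(** The directions sum up to s Y rather than Y so that the whole differential is
    divisible by s. *)
Lemma exists_chain_toeplitz (S : set 'M[K]_m.+1) : infinite_field K -> Q \in unitmx ->
  (q <= m)%N -> (q <= 2 * r)%N ->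
  (forall M : 'I_r.+1 -> 'M[K]_m.+1, (forall i, toeplitz (M i)) ->
     S ((\big[mulmx/1%:M]_(i < r.+1) M i) *m Q)) ->
  exists Z : nat -> set 'M[K]_m.+1,
    irreducible_chain (zariski_closure S) (q * m + (1 + 2 * m)) Z.
Proof.
move=> Kinf Qu qm qr SM.
have [s s0 free] := exists_injective_tangent Kinf Qu qm qr.
pose A j : 'M[K]_m.+1 := 1%:M + s *: base_dir K m j.
pose u (x : 'rV[K]_(q * m + (1 + 2 * m))) j :=
  if (j <= r)%N then partial_dir x j else s *: total_dir x.
pose X x j := u x j.+1 - u x j.
have ulin j : linear (u^~ j).
  rewrite /u; case: (j <= r)%N; first exact: partial_dir_linear.
  by move=> a x y; rewrite total_dir_linear scalerDr !scalerA mulrC.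
have Xlin j : linear (X^~ j) by exact: linear_mapB.
have XZ z x j : X (z *: x) j = z *: X x j by exact: (linear_mapZ _ _ (Xlin j)).
pose phi x := (\big[mulmx/1%:M]_(j < r.+1) (A j + X x j)) *m Q.
have dphi x : dprod A (X x) r.+1 *m Q = s *: tangent s x.
  rewrite dprod_abel; last by rewrite /u.
  rewrite {1}/u ltnn -scalemxAr -scalerDr -scalemxAl; congr (_ *: ((_ + _) *m _)).
  by apply: abel_tangent_ext => j jr; rewrite /u jr.
apply: (@exists_chain_of_immersion _ _ _ _ phi (s *: lin_matrix (tangent s))) => //.
- apply: polymapM; last exact: polymap_const.
  apply: polymap_prod => j; apply: polymapD; first exact: polymap_const.
  exact: polymap_of_linear.
- move=> x; apply: SM => j; rewrite -[A j]scale1r; apply: toeplitz_lin.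
    rewrite /A addrC; apply: toeplitz_lin; [exact: base_dir_toeplitz|exact: toeplitz1].
  have ut i : toeplitz (u x i).
    rewrite /u; case: (i <= r)%N; first exact: partial_dir_toeplitz.
    by rewrite -[_ *: _]addr0; apply: toeplitz_lin; [exact: toeplitz_mxP|exact: toeplitz0].
  exact: toeplitzB.
- have /row_freeP[E EE] := free; apply/row_freeP; exists (s^-1 *: E).
  by rewrite -scalemxAl -scalemxAr scalerA divff // scale1r.
- move=> x; have [H HE] := prod_expand A (X x) r.+1.
  exists (H *m map_mx polyC Q) => z.
  have phi0 : phi 0 = (\big[mulmx/1%:M]_(j < r.+1) A j) *m Q.
    rewrite /phi; congr (_ *m _); apply: eq_bigr => j _.
    by rewrite -(scale0r 0) XZ scale0r addr0.
  have phiz : phi (z *: x) = (\big[mulmx/1%:M]_(j < r.+1) (A j + z *: X x j)) *m Q.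
    by rewrite /phi; congr (_ *m _); apply: eq_bigr => j _; rewrite XZ.
  have -> : vec_mx (x *m (s *: lin_matrix (tangent s))) = s *: tangent s x.
    by rewrite -scalemxAr (mul_lin_matrix _ (tangent_linear s)) linearZ /= mxvecK.
  rewrite phi0 phiz HE !mulmxDl -!scalemxAl dphi.
  by rewrite (map_mxM (horner_eval z)) map_horner_polyC.
Qed.

End LowerBound.

(** * Toeplitz and Hankel factorizations *)

Lemma toeplitz_param (K : fieldType) m :
  exists lam : {linear 'rV[K]_(1 + 2 * m) -> 'M[K]_m.+1}, toeplitz (n:=m.+1) = range lam.
Proof.
pose f (x : 'rV[K]_(1 + 2 * m)) := toeplitz_mx m (fun t => x 0 (inord t)).
have [|F FE] := @linear_mx_map _ _ _ f.
  by move=> a x y; apply/matrixP => i j; rewrite !mxE.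
exists F; apply/seteqP; split=> [M tM|_ [x _ <-]]; last by rewrite -FE; exact: toeplitz_mxP.
exists (\row_t M (inord (t - m)) (inord (m - t))) => //.
rewrite -FE; apply/matrixP => i j; have := ltn_ord i; have := ltn_ord j => jm im.
have tE : (inord (i + (m - j)) : 'I_(1 + 2 * m)) = (i + (m - j))%N :> nat.
  by rewrite inordK //; lia.
by rewrite !mxE tE; apply: tM; rewrite !inordK; lia.
Qed.

Lemma hankel_param (K : fieldType) m :
  exists lam : {linear 'rV[K]_(1 + 2 * m) -> 'M[K]_m.+1}, hankel (n:=m.+1) = range lam.
Proof.
pose f (x : 'rV[K]_(1 + 2 * m)) : 'M[K]_m.+1 := \matrix_(i, j) x 0 (inord (i + j)).
have [|F FE] := @linear_mx_map _ _ _ f.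
  by move=> a x y; apply/matrixP => i j; rewrite !mxE.
exists F; apply/seteqP; split=> [M hM|_ [x _ <-]].
  exists (\row_t M (inord (t - m)) (inord (t - (t - m)))) => //.
  rewrite -FE; apply/matrixP => i j; have := ltn_ord i; have := ltn_ord j => jm im.
  have tE : (inord (i + j) : 'I_(1 + 2 * m)) = (i + j)%N :> nat by rewrite inordK //; lia.
  by rewrite !mxE tE; apply: hM; rewrite !inordK; lia.
by rewrite -FE => i j i' j' E; rewrite !mxE E.
Qed.

Definition exchange (K : fieldType) n : 'M[K]_n := \matrix_(i, j) (j == rev_ord i)%:R.

Lemma mul_exchange (K : fieldType) n (M : 'M[K]_n) i j :
  (exchange K n *m M) i j = M (rev_ord i) j.
Proof.
rewrite mxE (bigD1 (rev_ord i)) //= mxE eqxx mul1r big1 ?addr0 // => k ki.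
by rewrite mxE (negPf ki) mul0r.
Qed.

Lemma mul_mx_exchange (K : fieldType) n (M : 'M[K]_n) i j :
  (M *m exchange K n) i j = M i (rev_ord j).
Proof.
rewrite mxE (bigD1 (rev_ord j)) //= mxE rev_ordK eqxx mulr1 big1 ?addr0 // => k kj.
by rewrite mxE -(inj_eq rev_ord_inj) eq_sym rev_ordK (negPf kj) mulr0.
Qed.

Lemma exchangeK (K : fieldType) n : exchange K n *m exchange K n = 1%:M.
Proof. by apply/matrixP => i j; rewrite mul_exchange !mxE rev_ordK eq_sym. Qed.

Lemma exchange_unit (K : fieldType) n : exchange K n \in unitmx.
Proof. by case: (mulmx1_unit (exchangeK K n)). Qed.

Lemma hankel_mul_exchange (K : fieldType) n (M : 'M[K]_n) :
  toeplitz M -> hankel (M *m exchange K n) /\ hankel (exchange K n *m M).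
Proof.
move=> tM; split=> i j i' j' E; rewrite !(mul_exchange, mul_mx_exchange); apply: tM => /=;
by have := ltn_ord i; have := ltn_ord j; have := ltn_ord i'; have := ltn_ord j'; lia.
Qed.

(** Inserting the square of the exchange matrix between neighbouring factors pairs
    each exchange matrix with a Toeplitz factor; one is left over when r is odd. *)
Lemma hankel_products (K : fieldType) n r (M : 'I_r -> 'M[K]_n) :
  (forall i, toeplitz (M i)) ->
  products r (@hankel K n)
    ((\big[mulmx/1%:M]_(i < r) M i) *m (if odd r then exchange K n else 1%:M)).
Proof.
move=> tM.
exists (fun i : 'I_r => if odd i then exchange K n *m M i else M i *m exchange K n); split.
  by move=> i; have [? ?] := hankel_mul_exchange (tM i); case: ifP.
elim: r M {tM} => [|r IH] M; first by rewrite !big_ord0 mulmx1.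
rewrite !big_ord_recr /= -IH -!mulmxA; congr (_ *m _).
by case: (odd r) => /=; rewrite ?mul1mx // mulmxA exchangeK mul1mx mulmx1.
Qed.

Lemma has_krull_dim_products (K : fieldType) m r (V : set 'M[K]_m.+1) (Q : 'M[K]_m.+1)
    (lam : {linear 'rV[K]_(1 + 2 * m) -> 'M[K]_m.+1}) :
  infinite_field K -> V = range lam -> Q \in unitmx ->
  (forall M : 'I_r.+1 -> 'M[K]_m.+1, (forall i, toeplitz (M i)) ->
     products r.+1 V ((\big[mulmx/1%:M]_(i < r.+1) M i) *m Q)) ->
  has_krull_dim (factorization_variety r.+1 V)
    (minn (m.+1 ^ 2) (2 * r.+1 * (m.+1 - 1) + 1)).
Proof.
move=> Kinf VE Qu SV; split.
  have -> : (minn (m.+1 ^ 2) (2 * r.+1 * (m.+1 - 1) + 1) =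
             minn m (2 * r) * m + (1 + 2 * m))%N by rewrite /minn; do 2 case: ifP; nia.
  by apply: exists_chain_toeplitz Kinf Qu (geq_minl _ _) (geq_minr _ _) SV.
move=> k Z ch; rewrite leq_min; apply/andP; split.
  have -> : (m.+1 ^ 2 = m.+1 * m.+1)%N by rewrite expnS expn1.
  apply: (irreducible_chain_le (psi := vec_mx) _ _ ch); first exact: polymap_linear.
  by move=> p pv A _; apply: pv; exists (mxvec A) => //; rewrite mxvecK.
have [psi ppsi dense] := products_param r.+1 lam Kinf.
have -> : (2 * r.+1 * (m.+1 - 1) + 1 = 1 + r.+1 * (2 * m))%N by nia.
by apply: (irreducible_chain_le ppsi _ ch); rewrite VE.
Qed.

Lemma infinite_numField (K : numFieldType) : infinite_field K.
Proof.
move=> s; apply: contrapT => h.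
have all_s x : x \in s by apply: contrapT => xs; apply: h; exists x; apply/negP.
have u : uniq [seq (i%:R : K) | i <- iota 0 (size s).+1].
  by rewrite map_inj_uniq ?iota_uniq //; exact: Num.Theory.mulrIn (oner_neq0 K).
have := uniq_leq_size u (fun x _ => all_s x).
by rewrite size_map size_iota ltnn.
Qed.

Theorem theorem4p8 (R : realType) (n r : nat) (hn : (1 <= n)%N) (hr : (1 <= r)%N) :
  has_krull_dim (factorization_variety r (@toeplitz (complex R) n))
    (minn (n ^ 2) (2 * r * (n - 1) + 1)) /\
  has_krull_dim (factorization_variety r (@hankel (complex R) n))
    (minn (n ^ 2) (2 * r * (n - 1) + 1)).
Proof.
have Cinf := @infinite_numField (complex R).
case: n hn => // m _; case: r hr => // r _; split.
  have [lam lamE] := toeplitz_param (complex R) m.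
  apply: (has_krull_dim_products Cinf lamE (unitmx1 _ _)) => M tM.
  by rewrite mulmx1; exists M.
have [lam lamE] := hankel_param (complex R) m.
apply: (has_krull_dim_products Cinf lamE _ (@hankel_products _ _ _)).
by case: ifP => _; rewrite ?unitmx1 ?exchange_unit.
Qed.
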